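(* Let $X$ be a rearrangement invariant space on $(-1,1)$ satisfying either $1/2<\underline{\alpha}_X\le \overline{\alpha}_X<1$ or $0<\underline{\alpha}_X\le \overline{\alpha}_X<1/2$. Then the finite Hilbert transform $T_X\colon X\to X$ has no $X$-valued, continuous linear extension to any larger Banach function space; that is, there is no Banach function space $Z$ with $X\subsetneq Z\subseteq L^1$ such that $T$ maps $Z$ continuously into $X$.
   Context: We work on $(-1,1)$ with Lebesgue measure. A Banach function space (B.f.s.) is a Banach space $Z$ of (classes of) complex measurable functions with the ideal property ($f\in Z$, $|g|\le|f|$ a.e. imply $g\in Z$, $\|g\|_Z\le\|f\|_Z$) and the Fatou property. A rearrangement invariant (r.i.) space is a B.f.s. $X$ with $g\in X$, $\|g\|_X\le\|f\|_X$ whenever $f\in X$ and $g^*\le f^*$ ($f^*$ the decreasing rearrangement). For $t>0$ let $E_t f(s)=f(st)$ if $|st|\le1$, $0$ otherwise; the Boyd indices are $\underline{\alpha}_X=\sup_{0<t<1}\frac{\log\|E_{1/t}\|_{X\to X}}{\log t}$ and $\overline{\alpha}_X=\inf_{1<t<\infty}\frac{\log\|E_{1/t}\|_{X\to X}}{\log t}$. The finite Hilbert transform of $f\in L^1(-1,1)$ is $(Tf)(t)=\lim_{\varepsilon\to0^+}\frac1\pi\big(\int_{-1}^{t-\varepsilon}+\int_{t+\varepsilon}^1\big)\frac{f(x)}{x-t}\,dx$ (exists a.e.); for such $X$ it maps $X$ boundedly into $X$, denoted $T_X$. *)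

(* Defs.v *)
From HB Require Import structures.
From mathcomp Require Import all_boot all_order all_algebra.
From mathcomp Require Import all_classical all_reals all_analysis.
From mathcomp Require Import complex.

Set Implicit Arguments.
Unset Strict Implicit.
Unset Printing Implicit Defensive.

Import Order.TTheory GRing.Theory Num.Theory.
Import numFieldNormedType.Exports.

Local Open Scope classical_set_scope.
Local Open Scope ring_scope.

Section FiniteHilbert.
Variable R : realType.
Local Notation C := R[i].
Local Notation mu := (@lebesgue_measure R).

Definition I11 : set R := `]-1, 1[.

Definition cabs (z : C) : R := Num.sqrt (complex.Re z ^+ 2 + complex.Im z ^+ 2).

Definition cmeas (f : R -> C) : Prop :=
  measurable_fun I11 (fun x => complex.Re (f x)) /\ measurable_fun I11 (fun x => complex.Im (f x)).

Definition ae11 (P : R -> Prop) : Prop := {ae mu, forall x, I11 x -> P x}.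

Definition L1 (f : R -> C) : Prop :=
  cmeas f /\ (\int[mu]_(x in I11) (cabs (f x))%:E < +oo)%E.

(** Banach function space on (-1,1): a Banach space (Z, N) of (a.e.-classes of)
    measurable complex functions with the ideal property and the Fatou property.
    Functions are identified a.e.: N is a seminorm vanishing exactly on
    a.e.-null functions, and the ideal property makes Z and N a.e.-invariant. *)
Record is_bfs (Z : set (R -> C)) (N : (R -> C) -> R) : Prop := {
  bfs_meas : forall f, Z f -> cmeas f;
  bfs_zero : Z (fun=> 0);
  bfs_add : forall f g, Z f -> Z g -> Z (fun x => f x + g x);
  bfs_scale : forall (c : C) f, Z f -> Z (fun x => c * f x);
  bfs_norm_ge0 : forall f, Z f -> 0 <= N f;
  bfs_norm_eq0 : forall f, Z f -> (N f = 0 <-> ae11 (fun x => f x = 0));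
  bfs_norm_triangle : forall f g, Z f -> Z g -> N (fun x => f x + g x) <= N f + N g;
  bfs_norm_scale : forall (c : C) f, Z f -> N (fun x => c * f x) = cabs c * N f;
  bfs_complete : forall u : nat -> R -> C, (forall n, Z (u n)) ->
    (forall e : R, 0 < e -> exists M : nat, forall n m, (M <= n)%N -> (M <= m)%N ->
        N (fun x => u n x - u m x) <= e) ->
    exists f, Z f /\ (fun n => N (fun x => u n x - f x)) @ \oo --> (0 : R);
  bfs_ideal : forall f g, Z f -> cmeas g ->
    ae11 (fun x => cabs (g x) <= cabs (f x)) -> Z g /\ N g <= N f;
  bfs_fatou : forall (u : nat -> R -> C) f, (forall n, Z (u n)) -> cmeas f ->
    ae11 (fun x => (forall n m, (n <= m)%N -> cabs (u n x) <= cabs (u m x)) /\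
                   (fun n => cabs (u n x)) @ \oo --> cabs (f x)) ->
    (exists M : R, forall n, N (u n) <= M) ->
    Z f /\ (fun n => N (u n)) @ \oo --> N f }.

Definition distrib (f : R -> C) (l : R) : \bar R :=
  mu [set x | I11 x /\ l < cabs (f x)].

Definition rearr (f : R -> C) (s : R) : \bar R :=
  ereal_inf [set l%:E | l in [set l : R | 0 <= l /\ (distrib f l <= s%:E)%E]].

Definition is_ri (X : set (R -> C)) (N : (R -> C) -> R) : Prop :=
  is_bfs X N /\
  forall f g, X f -> cmeas g -> (forall s, 0 < s -> (rearr g s <= rearr f s)%E) ->
    X g /\ N g <= N f.

Definition dil (t : R) (f : R -> C) : R -> C :=
  fun s => if `|s * t| <= 1 then f (s * t) else 0.

Definition dil_norm (X : set (R -> C)) (N : (R -> C) -> R) (t : R) : \bar R :=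
  ereal_sup [set y : \bar R | exists f, [/\ X f, N f <= 1 &
     (X (dil t^-1 f) /\ y = (N (dil t^-1 f))%:E) \/ (~ X (dil t^-1 f) /\ y = +oo%E)]].

Definition lower_boyd (X : set (R -> C)) (N : (R -> C) -> R) : \bar R :=
  ereal_sup [set (ln (fine (dil_norm X N t)) / ln t)%:E | t in `]0, 1[].

Definition upper_boyd (X : set (R -> C)) (N : (R -> C) -> R) : \bar R :=
  ereal_inf [set (ln (fine (dil_norm X N t)) / ln t)%:E | t in `]1, +oo[].

Definition hilb_trunc (g : R -> R) (t e : R) : R :=
  pi^-1 * Rintegral mu [set x | I11 x /\ e <= `|x - t|] (fun x => g x / (x - t)).

Definition hilbR (g : R -> R) (t : R) : R := lim (hilb_trunc g t @ 0^'+).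

Definition hilbert (f : R -> C) : R -> C :=
  fun t => Complex (hilbR (fun x => complex.Re (f x)) t) (hilbR (fun x => complex.Im (f x)) t).

End FiniteHilbert.

(* Main.v *)
Require Import Defs.
From HB Require Import structures.
From mathcomp Require Import all_boot all_order all_algebra.
From mathcomp Require Import all_classical all_reals all_analysis.
From mathcomp Require Import measurable_realfun complex.
From mathcomp Require Import zify lra ring.
Import Order.TTheory GRing.Theory Num.Theory.
Import numFieldNormedType.Exports.
Local Open Scope classical_set_scope.
Local Open Scope ring_scope.
Set Implicit Arguments.
Unset Strict Implicit.

(** If T maps Z into X boundedly, then already Z is contained in X.  Let
    g = |f| with f in Z, and cut (-1,1) into cells of length 1/(n+1).  Multiply
    g by signs that are constant on the cells and by the indicator of the cells
    whose index is a fixed residue p mod 4.  For t in a cell of index k with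
    k + 2 = p mod 4, the modulated function vanishes near t, so T of it is an
    ordinary integral at t, and flipping the sign of the cell k + 2 changes the
    value at t by at least 2/(3 pi) times the mean of g over that cell.  Hence
    the average over all signs of |T (modulated g)|, summed over p, dominates
    1/(3 pi) times the mean of g over the cell k + 2.  Its X-norm is bounded by
    the Z-norm of g uniformly in n.  As n grows, these means tend to g a.e. by
    Lebesgue differentiation, so the Fatou property puts g in X.  *)

Definition cplx (R : realType) (u : R -> R) : R -> R[i] := fun x => Complex (u x) 0.

(** * Moduli of complex-valued functions *)

Section Cabs.
Variable R : realType.
Implicit Types (z : R[i]) (u : R -> R) (f : R -> R[i]).

Lemma measurable_I11 : measurable (@I11 R).
Proof. exact: measurable_itv. Qed.

Lemma cabs_ge0 z : 0 <= cabs z.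
Proof. exact: sqrtr_ge0. Qed.

Lemma cabs_real (r : R) : cabs (Complex r 0) = `|r|.
Proof. by rewrite /cabs /= expr0n /= addr0 sqrtr_sqr. Qed.

Lemma normr_Re_le_cabs z : `|complex.Re z| <= cabs z.
Proof. by rewrite -sqrtr_sqr ler_wsqrtr // lerDl sqr_ge0. Qed.

Lemma cmeas_cplx u : measurable_fun (@I11 R) u -> cmeas (cplx u).
Proof. by move=> mu; split=> //=; exact: measurable_cst. Qed.

Lemma measurable_cabs f : cmeas f -> measurable_fun (@I11 R) (fun x => cabs (f x)).
Proof.
move=> [mRe mIm].
have ms : measurable_fun [set: R] (@Num.sqrt R).
  by apply: continuous_measurable_fun; exact: sqrt_continuous.
apply: (measurableT_comp ms).
by apply: measurable_funD; apply: measurable_funX.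
Qed.

End Cabs.

Lemma ae11W (R : realType) (P : R -> Prop) : (forall x, I11 x -> P x) -> ae11 P.
Proof. by move=> h; apply: aeW. Qed.

(** * Norm estimates and limits in a Banach function space *)

Section BanachFunctionSpace.
Variables (R : realType) (X : set (R -> R[i])) (N : (R -> R[i]) -> R).
Hypothesis bX : is_bfs X N.
Local Notation mu := (@lebesgue_measure R).
Implicit Types (f : R -> R[i]) (u v : R -> R).

Lemma bfs_dominated f (g : R -> R[i]) : X f -> cmeas g ->
  (forall x, I11 x -> cabs (g x) <= cabs (f x)) -> X g /\ N g <= N f.
Proof. by move=> Xf mg fg; apply: (bfs_ideal bX) => //; exact: ae11W. Qed.

Lemma bfs_cabs f : X f ->
  X (cplx (fun x => cabs (f x))) /\ N (cplx (fun x => cabs (f x))) <= N f.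
Proof.
move=> Xf; apply: bfs_dominated => //.
  by apply: cmeas_cplx; apply: measurable_cabs; exact: (bfs_meas bX).
by move=> x _; rewrite cabs_real ger0_norm // cabs_ge0.
Qed.

(** Each modulus lies in [X] by the ideal property; the triangle inequality is then iterated along
    [s]. It serves to average over all sign patterns. *)
Lemma bfs_sum_cabs (I : Type) (s : seq I) (f : I -> R -> R[i]) :
  (forall i, X (f i)) ->
  X (cplx (fun x => \sum_(i <- s) cabs (f i x))) /\
  N (cplx (fun x => \sum_(i <- s) cabs (f i x))) <= \sum_(i <- s) N (f i).
Proof.
move=> Xf; elim: s => [|i s [Xs Ns]].
  have -> : cplx (fun x : R => \sum_(i <- [::]) cabs (f i x)) = fun=> 0.
    by apply/funext => x; rewrite /cplx big_nil.
  split; first exact: (bfs_zero bX).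
  rewrite big_nil ((bfs_norm_eq0 bX (bfs_zero bX)).2 _)//.
  exact: ae11W.
have -> : cplx (fun x : R => \sum_(i <- i :: s) cabs (f i x)) =
    fun x => cplx (fun x => cabs (f i x)) x + cplx (fun x => \sum_(i <- s) cabs (f i x)) x.
  by apply/funext => x; rewrite /cplx big_cons /=; apply/eqP; rewrite eq_complex /= addr0 !eqxx.
have [Xi Ni] := bfs_cabs (Xf i).
split; first exact: (bfs_add bX).
rewrite big_cons; apply: le_trans (bfs_norm_triangle bX _ _) _ => //.
exact: lerD.
Qed.

Lemma bfs_scale_cplx (r : R) u : 0 <= r -> X (cplx u) ->
  X (cplx (fun x => r * u x)) /\ N (cplx (fun x => r * u x)) = r * N (cplx u).
Proof.
move=> r0 Xu.
have -> : cplx (fun x => r * u x) = fun x => Complex r 0 * cplx u x.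
  apply/funext => x; rewrite /cplx; apply/eqP.
  by rewrite eq_complex /= !mulr0 !mul0r subr0 addr0 !eqxx.
split; first exact: (bfs_scale bX).
by rewrite (bfs_norm_scale bX) // cabs_real ger0_norm.
Qed.

(* The Fatou property is applied to the increasing sequence [inf_(m >= n) u m]. *)
Lemma bfs_cvg_bounded (u : nat -> R -> R) (g : R -> R) (M : R) :
  (forall n x, 0 <= u n x) -> (forall n, X (cplx (u n))) ->
  (forall n, N (cplx (u n)) <= M) ->
  measurable_fun (@I11 R) g ->
  ae11 (fun x => u ^~ x @ \oo --> g x) ->
  X (cplx g).
Proof.
move=> u0 Xu Nu mg ug.
have lb x : has_lbound (range (u ^~ x)).
  by exists 0 => _ [n _ <-].
pose v n x := infs (u ^~ x) n.
have v0 n x : 0 <= v n x.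
  apply: lb_le_inf; first by exists (u n x), n => //=.
  by move=> _ [m _ <-].
have vu n x : v n x <= u n x.
  apply: ge_inf; last by exists n => /=.
  by exists 0 => _ [m _ <-].
have mu_ n : measurable_fun (@I11 R) (u n) by have [] := bfs_meas bX (Xu n).
have mv n : measurable_fun (@I11 R) (v n).
  by apply: measurable_fun_infs => //.
have Xv n : X (cplx (v n)) /\ N (cplx (v n)) <= N (cplx (u n)).
  apply: bfs_dominated => //; first exact: cmeas_cplx.
  by move=> x _; rewrite !cabs_real !ger0_norm.
apply: (bfs_fatou bX (u := fun n => cplx (v n)) _ (cmeas_cplx mg) _ _).1.
- by move=> n; case: (Xv n).
- rewrite /ae11 in ug *.
  apply: (@filterS _ _ (ae_filter_ringOfSetsType mu)) ug => x /[apply] ux; split.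
    move=> n m nm; rewrite !cabs_real !ger0_norm //.
    exact: (nondecreasing_infs (lb x)).
  rewrite cabs_real.
  under eq_fun do rewrite cabs_real.
  apply: cvg_norm; exact: cvg_infs.
- by exists M => n; case: (Xv n) => _ /le_trans; apply.
Qed.

End BanachFunctionSpace.

(** * Partition of the line into cells of equal length *)

Section Cells.
Variables (R : realType) (n : nat).

(** Counting starts at the left endpoint -1, so the cells meeting (-1,1) are those of index 0 to
    2n+1; hence the bound [n.*2.+2] below. *)
Definition cell (x : R) : int := Num.floor ((x + 1) * n.+1%:R).

Definition block (k : int) : set R :=
  `[k%:~R / n.+1%:R - 1, (k + 1)%:~R / n.+1%:R - 1[.

Lemma in_block k x : block k x <-> cell x = k.
Proof.
rewrite /block /= in_itv /= lerBlDr ltrBrDr ler_pdivrMr ?ltr0Sn // ltr_pdivlMr ?ltr0Sn //.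
by rewrite -floor_eq; split=> /eqP.
Qed.

Lemma measurable_block k : measurable (block k).
Proof. exact: measurable_itv. Qed.

(** A function of the cell index is constant on each block, so its preimages are countable unions of
    blocks. *)
Lemma measurable_fun_cell (D : set R) (F : int -> R) : measurable_fun D (F \o cell).
Proof.
move=> mD Y mY; apply: measurableI => //.
have -> : (F \o cell) @^-1` Y = \bigcup_k [set x | block k x /\ Y (F k)].
  apply/seteqP; split=> [x Yx|x [k _ [/in_block <-]]] //.
  by exists (cell x) => //; split=> //; apply/in_block.
apply: countable_bigcupT_measurable => [|k]; first exact: countableP.
have [YF|YF] := pselect (Y (F k)).
  rewrite (_ : [set _ | _] = block k); first exact: measurable_block.
  by apply/seteqP; split=> x //= [].
rewrite (_ : [set _ | _] = set0); first exact: measurable0.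
by apply/seteqP; split=> x //= [].
Qed.

Lemma cell_bounds x : (cell x)%:~R / n.+1%:R <= x + 1 < ((cell x)%:~R + 1) / n.+1%:R.
Proof.
rewrite ler_pdivrMr ?ltr0Sn // ltr_pdivlMr ?ltr0Sn //.
have := floor_itv ((x + 1) * n.+1%:R).
by rewrite intrD.
Qed.

Lemma cell_ge0 x : I11 x -> 0 <= cell x.
Proof.
rewrite /I11 /= in_itv /= => /andP[x1 _].
by rewrite floor_ge0 mulr_ge0 // -lerBlDr sub0r ltW.
Qed.

Lemma cell_lt x : I11 x -> (`|cell x| < n.*2.+2)%N.
Proof.
move=> Ix; have c0 := cell_ge0 Ix.
move: Ix; rewrite /I11 /= in_itv /= => /andP[_ x1].
have : cell x < (n.*2.+2)%:Z.
  rewrite floor_lt_int (_ : (n.*2.+2)%:Z%:~R = 2 * n.+1%:R :> R).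
    by rewrite ltr_pM2r ?ltr0Sn //; lra.
  by rewrite -doubleS -mul2n -pmulrn natrM.
lia.
Qed.

End Cells.

(** * Sign patterns on the cells and averaging over them *)

Section Signs.
Variables (R : realType) (n : nat).
Local Notation signs := {ffun 'I_(n.*2.+2) -> bool}.

(** There is one bit per cell meeting (-1,1). [inord] sends any other index to 0, which is harmless
    because the functions to be modulated vanish outside (-1,1). *)
Definition sgn (p : 'I_4) (w : signs) (k : int) : R :=
  if (`|k| %% 4 == p)%N then (-1) ^+ w (inord `|k|%N) else 0.

Lemma normr_sgn_le1 p w k : `|sgn p w k| <= 1.
Proof. by rewrite /sgn; case: ifP => _; rewrite ?normr0 // normrX normrN1 expr1n. Qed.

Definition flip (i : 'I_(n.*2.+2)) (w : signs) : signs :=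
  [ffun j => w j (+) (j == i)].

Lemma flipK i : involutive (flip i).
Proof. by move=> w; apply/ffunP => j; rewrite !ffunE -addbA addbb addbF. Qed.

Lemma sgn_flip (p : 'I_4) (w : signs) (k l : int) :
  (`|k| < n.*2.+2)%N -> (`|l| < n.*2.+2)%N -> (`|k| %% 4 = p)%N -> 0 <= k -> 0 <= l ->
  sgn p w l - sgn p (flip (inord `|k|) w) l = if l == k then 2 * sgn p w k else 0.
Proof.
move=> kn ln kp k0 l0; rewrite /sgn.
have [->|lk] := eqVneq l k.
  by rewrite kp eqxx ffunE eqxx; case: (w _) => /=; rewrite ?expr1 ?expr0; lra.
case: ifP => _; last by rewrite subr0.
(* [inord] and the absolute value are injective on the indices at hand, these being in range and
   nonnegative. *)
rewrite ffunE; have -> : (inord `|l| == inord `|k| :> 'I_(n.*2.+2)) = false.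
  apply/negbTE/eqP => /(congr1 val) /=; rewrite !inordK // => e.
  by move/eqP: lk; apply; lia.
by rewrite addbF subrr.
Qed.

Lemma normr_sgn1 (p : 'I_4) w k : (`|k| %% 4 = p)%N -> `|sgn p w k| = 1.
Proof. by move=> e; rewrite /sgn e eqxx normrX normrN1 expr1n. Qed.

(* Each [F w] is paired with [F (flip i w)]. *)
Lemma sum_flip_ge (i : 'I_(n.*2.+2)) (F : signs -> R) (a : R) :
  (forall w, 2 * a <= `|F w - F (flip i w)|) ->
  (2 ^ n.*2.+2)%:R * a <= \sum_w `|F w|.
Proof.
move=> Fa; rewrite -(ler_pM2l (ltr0Sn R 1)) mulrCA.
have -> : 2 * (\sum_w `|F w|) = \sum_w (`|F w| + `|F (flip i w)|).
  rewrite big_split /= mulr_natl mulr2n; congr (_ + _).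
  by rewrite (reindex_inj (inv_inj (flipK i))).
have -> : (2 ^ n.*2.+2)%:R * (2 * a) = \sum_(w : signs) 2 * a.
  by rewrite sumr_const card_ffun card_bool card_ord mulr_natl.
apply: ler_sum => w _; apply: le_trans (Fa w) _; exact: ler_normB.
Qed.

End Signs.

(** * The Hilbert transform at a point away from the support *)

Section OffSupport.
Variable R : realType.
Local Notation mu := (@lebesgue_measure R).

(** The inverse is total, with value 0 at 0; splitting off that point leaves a continuous function
    on an open set. *)
Lemma measurable_fun_inv : measurable_fun [set: R] (@GRing.inv R).
Proof.
have -> : [set: R] = [set 0] `|` ~` [set 0] by rewrite setUv.
apply/measurable_funU => //; first exact: measurableC.
split; first exact: measurable_fun_set1.
apply: open_continuous_measurable_fun.
  by rewrite openC; exact: accessible_closed_set1 (hausdorff_accessible (@Rhausdorff R)) 0.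
by move=> x; rewrite inE /= => /eqP x0; exact: inv_continuous.
Qed.

Variables (h : R -> R) (t d : R).
Hypotheses (d0 : 0 < d) (h_far : forall y, `|y - t| < d -> h y = 0).

(** A truncation at [e < d] removes only points where [h] vanishes, so the truncated integrals are
    constant near [0] and no principal value remains. *)
Lemma hilbR_off_support : (forall y, ~ I11 y -> h y = 0) ->
  hilbR h t = pi^-1 * Rintegral mu setT (fun y => h y / (y - t)).
Proof.
move=> h_out; rewrite /hilbR; apply: lim_near_cst => //.
near=> e; rewrite /hilb_trunc Rintegral_mkcond; congr (_ * _); congr Rintegral.
apply/funext => y; rewrite patchE.
case: ifPn => // /negP; rewrite inE /= => /not_andP[/h_out ->|/negP]; rewrite ?mul0r //.
rewrite -ltNge => ye; rewrite h_far ?mul0r //; apply: lt_trans ye _.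
by near: e; exact: nbhs_right_lt.
Unshelve. all: by end_near. Qed.

(** Where [h] is nonzero the kernel is at most [d^-1] in modulus. *)
Lemma integrable_off_support : mu.-integrable setT (EFin \o h) ->
  mu.-integrable setT (EFin \o (fun y => h y / (y - t))).
Proof.
move=> ih; have /integrableP[/measurable_EFinP mh _] := ih.
apply: (le_integrable _ _ _ (integrableZl measurableT d^-1 ih)) => //.
- apply/measurable_EFinP; apply: measurable_funM => //.
  apply: (measurableT_comp measurable_fun_inv).
  exact: measurable_funB.
- move=> y _ /=; rewrite lee_fin !normrM mulrC.
  have [yd|yd] := ltP `|y - t| d; first by rewrite h_far // normr0 !mulr0.
  apply: ler_wpM2r => //; rewrite !normfV (gtr0_norm d0) lef_pV2 // posrE.
  exact: lt_le_trans yd.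
Qed.

End OffSupport.

(** * Effect of one sign flip on the Hilbert transform *)

Section LocalAverage.
Variables (R : realType) (g : R -> R) (n : nat).
Local Notation mu := (@lebesgue_measure R).
Local Notation signs := {ffun 'I_(n.*2.+2) -> bool}.
Hypotheses (g_ge0 : forall x, 0 <= g x) (g_out : forall x, ~ I11 x -> g x = 0)
  (ig : mu.-integrable setT (EFin \o g)).

Definition modulated (p : 'I_4) (w : signs) (x : R) : R := sgn R p w (cell n x) * g x.

(** The mean of [g] over the cell two places to the right of that of [x]; the factor is the inverse
    of the cell length. *)
Definition shifted_avg (x : R) : R :=
  n.+1%:R * Rintegral mu (block n (cell n x + 2)) g.

Lemma measurable_modulated p w : measurable_fun setT (modulated p w).
Proof.
apply: measurable_funM; first exact: measurable_fun_cell.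
by have /integrableP[/measurable_EFinP] := ig.
Qed.

Lemma normr_modulated_le p w x : `|modulated p w x| <= g x.
Proof.
rewrite /modulated normrM (ger0_norm (g_ge0 x)) ler_piMl //.
exact: normr_sgn_le1.
Qed.

Lemma integrable_modulated p w : mu.-integrable setT (EFin \o modulated p w).
Proof.
apply: (le_integrable _ _ _ ig) => //.
  by apply/measurable_EFinP; exact: measurable_modulated.
move=> x _; rewrite /= lee_fin (ger0_norm (g_ge0 x)).
exact: normr_modulated_le.
Qed.

Lemma measurable_shifted_avg (D : set R) : measurable_fun D shifted_avg.
Proof.
exact: (@measurable_fun_cell R n D (fun k => n.+1%:R * Rintegral mu (block n (k + 2)) g)).
Qed.

Lemma shifted_avg_ge0 x : 0 <= shifted_avg x.
Proof. by rewrite mulr_ge0 // Rintegral_ge0. Qed.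

Section AtPoint.
Variables (t : R) (p : 'I_4).
Local Notation k := (cell n t + 2).
Hypotheses (It : I11 t) (tp : (`|k| %% 4)%N = p :> nat).
Local Notation i := (inord `|k|%N : 'I_(n.*2.+2)).

(** The cell of such a [y] has index [k - 3], [k - 2] or [k - 1], and none of these is congruent to
    [k] modulo 4. Modulus 3 would let [k - 3] in. *)
Lemma modulated_far w y : `|y - t| < n.+1%:R^-1 -> modulated p w y = 0.
Proof.
move=> yt; have [Iy|Iy] := pselect (I11 y); last by rewrite /modulated g_out ?mulr0.
rewrite /modulated /sgn ifF ?mul0r //; apply/negbTE/eqP => yp.
have e0 : 0 < n.+1%:R^-1 :> R by rewrite invr_gt0.
have i2 : 2%:~R = 2 :> R by [].
set e := n.+1%:R^-1 in yt e0 *; move: yt; rewrite ltr_norml => /andP[yt1 yt2].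
have := cell_bounds n y; have := cell_bounds n t; rewrite -/e => /andP[t1 t2] /andP[y1 y2].
have c1 : cell n y < cell n t + 2.
  by rewrite -(ltr_int R) intrD i2 -(ltr_pM2r e0); lra.
have c2 : cell n t < cell n y + 2.
  by rewrite -(ltr_int R) intrD i2 -(ltr_pM2r e0); lra.
have ct := cell_ge0 n It; have cy := cell_ge0 n Iy.
have := ltn_ord p; lia.
Qed.

Lemma modulated_flip w y : (`|k| < n.*2.+2)%N ->
  modulated p w y - modulated p (flip i w) y = 2 * sgn R p w k * (g \_ (block n k)) y.
Proof.
move=> kn; rewrite /modulated -mulrBl patchE.
have [Iy|Iy] := pselect (I11 y); last by rewrite g_out // if_same !mulr0.
have k0 : 0 <= k by rewrite addr_ge0 // cell_ge0.
rewrite sgn_flip //; [|exact: cell_lt|exact: cell_ge0].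
have [/eqP ck|/eqP ck] := boolP (cell n y == k).
  by rewrite mem_set //; exact/in_block.
by rewrite memNset ?mul0r ?mulr0 // => /in_block.
Qed.

(** Exactly one whole cell separates the cell of [t] from this block, and three cells cover the
    distance. *)
Lemma block_shift2_dist y : block n k y ->
  n.+1%:R^-1 <= y - t <= 3 * n.+1%:R^-1.
Proof.
move=> /in_block yk; have := cell_bounds n y; have := cell_bounds n t; rewrite yk.
rewrite intrD -[2%:~R]/(2 : R); set e := n.+1%:R^-1 => /andP[t1 t2] /andP[y1 y2].
by apply/andP; split; lra.
Qed.

(** By linearity only the block [k] survives in the difference, with the constant coefficient
    [2 * sgn R p w k]. On that block [g / (y - t)] is nonnegative, so nothing cancels. *)
Lemma hilbR_modulated_flip w : (`|k| < n.*2.+2)%N ->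
  2 * ((3 * pi)^-1 * shifted_avg t) <=
  `|hilbR (modulated p w) t - hilbR (modulated p (flip i w)) t|.
Proof.
move=> kn; have n0 : 0 < n.+1%:R^-1 :> R by rewrite invr_gt0 ltr0Sn.
have out w' y : ~ I11 y -> modulated p w' y = 0.
  by move=> /g_out g0; rewrite /modulated g0 mulr0.
have far w' := @modulated_far w'.
rewrite !(hilbR_off_support n0 (far _) (out _)).
have int w' := integrable_off_support n0 (far w') (integrable_modulated p w').
rewrite -mulrBr -RintegralB //.
have igB : mu.-integrable setT (EFin \o (g \_ (block n k))).
  rewrite -restrict_EFin; apply/integrable_restrict => //.
    exact: measurable_block.
  by apply: integrableS ig => //; rewrite setTI; exact: measurable_block.
have igBt : mu.-integrable setT (EFin \o (fun y => (g \_ (block n k)) y / (y - t))).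
  apply: (integrable_off_support n0) => // y yt; rewrite patchE; case: ifPn => // /set_mem yB.
  have /andP[yt1 _] := block_shift2_dist yB.
  by move: yt; rewrite ger0_norm ?ltNge ?yt1 // (le_trans (ltW n0)).
rewrite (_ : (fun y => _) = (fun y => (2 * sgn R p w k) * ((g \_ (block n k)) y / (y - t)))).
  2: by apply/funext => y; rewrite -mulrBl modulated_flip // mulrA.
rewrite RintegralZl // !normrM normr_sgn1 // mulr1 /shifted_avg Rintegral_mkcond.
(* On the block [0 < y - t <= 3 / (n+1)], so the kernel is at least [(n+1) / 3]. *)
have ineq : n.+1%:R / 3 * Rintegral mu setT (g \_ (block n k)) <=
   Rintegral mu setT (fun y => (g \_ (block n k)) y / (y - t)).
  rewrite -RintegralZl //; apply: le_Rintegral => //.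
    exact: (integrableZl measurableT _ igB).
  move=> y _; rewrite patchE; case: ifPn => [/set_mem yB|_]; last by rewrite mulr0 mul0r.
  have /andP[yt1 yt3] := block_shift2_dist yB.
  rewrite mulrC ler_wpM2l // -[leLHS]invrK lef_pV2 ?posrE ?invf_div //.
  exact: lt_le_trans yt1.
have c0 : 0 < pi^-1 :> R by rewrite invr_gt0 pi_gt0.
apply: le_trans (_ : pi^-1 * (2 * (n.+1%:R / 3 * Rintegral mu setT (g \_ (block n k)))) <= _).
  by rewrite invfM; set c := pi^-1; rewrite -subr_ge0 le_eqVlt; apply/orP; left; apply/eqP; field.
rewrite (gtr0_norm c0) (ger0_norm (ler0n _ 2)) ler_pM2l // ler_pM2l //.
exact: le_trans ineq (ler_norm _).
Qed.
End AtPoint.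
End LocalAverage.

(** * Pointwise domination of the local means, and their convergence *)

Section AveragedHilbert.
Variables (R : realType) (g : R -> R).
Local Notation mu := (@lebesgue_measure R).
Hypotheses (g_ge0 : forall x, 0 <= g x) (g_out : forall x, ~ I11 x -> g x = 0)
  (ig : mu.-integrable setT (EFin \o g)).

(** The relevant residue depends on [t]; summing over all four gives a single majorant valid for
    every [t]. *)
Lemma shifted_avg_le n t : I11 t ->
  shifted_avg g n t <= (3 * pi) / (2 ^ n.*2.+2)%:R *
    \sum_(q : 'I_4 * {ffun 'I_(n.*2.+2) -> bool}) `|hilbR (modulated g q.1 q.2) t|.
Proof.
move=> It; set k := cell n t + 2.
have c0 : 0 < 3 * pi :> R by rewrite mulr_gt0 // pi_gt0.
have N0 : 0 < (2 ^ n.*2.+2)%:R :> R by rewrite ltr0n expn_gt0.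
have [kn|kn] := ltnP `|k|%N (n.*2.+2); last first.
  (* Here [t] is in one of the last two cells, so the block two places further lies beyond 1, where
     [g] vanishes. *)
  rewrite /shifted_avg Rintegral_mkcond (_ : g \_ _ = fun=> 0); last first.
    apply/funext => y; rewrite patchE; case: ifPn => // /set_mem /in_block yk.
    apply: g_out => /cell_lt; rewrite -/k in yk => /(_ n); rewrite yk; lia.
  rewrite Rintegral_cst // mul0r mulr0.
  by rewrite mulr_ge0 ?divr_ge0 ?(ltW c0) ?sumr_ge0.
have p4 : (`|k| %% 4 < 4)%N by rewrite ltn_mod.
pose p := Ordinal p4.
have := @sum_flip_ge R n (inord `|k|) (fun w => hilbR (modulated g p w) t)
  ((3 * pi)^-1 * shifted_avg g n t).
move=> /(_ (fun w => @hilbR_modulated_flip R g n g_ge0 g_out ig t p It erefl w kn)) le1.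
rewrite -ler_pdivrMl ?divr_gt0 // invf_div -mulrA.
apply: le_trans le1 _.
(* Only the residue of [k] is kept; the other three contribute nonnegative terms. *)
rewrite -(pair_bigA _ (fun p w => `|hilbR (modulated g p w) t|)) /= (bigD1 p) //=.
by rewrite lerDl; apply: sumr_ge0 => p' _; exact: sumr_ge0.
Qed.

(** The blocks need not contain [x]: Lebesgue differentiation holds along sets filling a fixed
    proportion of balls shrinking to [x]. *)
Lemma shifted_avg_cvg :
  {ae mu, forall x, shifted_avg g ^~ x @ \oo --> g x}.
Proof.
have locg := open_integrable_locally openT ig.
(* The block is within [3 / (n+1)] of [x], so the open ball of radius [4 / (n+1)] contains it and
   has 8 times its measure. *)
pose r n : {posnum R} := PosNum (divr_gt0 (ltr0Sn R 3) (ltr0Sn R n)).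
have mu_block n k : mu (block n k) = (n.+1%:R^-1)%:E.
  rewrite lebesgue_measure_itv /= intrD lte_fin ltrD2r ltr_pM2r ?invr_gt0 // ltrDl ltr01.
  by rewrite -EFinD; congr EFin; set e := n.+1%:R^-1; lra.
have shr (x : R) : nicely_shrinking x (fun n => block n (cell n x + 2)).
  split; first by move=> n; exact: measurable_block.
  exists ((8 : R), r); split => //=.
  - by rewrite -[0](mulr0 4); apply: cvgM; [exact: cvg_cst|exact: cvg_harmonic].
  - move=> n y /block_shift2_dist /andP[y1 y2].
    rewrite /ball /= distrC ger0_norm; last by apply: le_trans y1; rewrite invr_ge0.
    by apply: le_lt_trans y2 _; rewrite ltr_pM2r ?invr_gt0 // ltr_nat.
  - move=> n; rewrite lebesgue_measure_ball // mu_block -EFinM lee_fin.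
    by rewrite /=; set e := n.+1%:R^-1; lra.
apply: filterS; first exact: (ae_filter_ringOfSetsType mu).
  2: exact: (lebesgue_differentiation locg).
move=> x /(nice_lebesgue_differentiation shr locg) /fine_cvg.
apply: cvg_trans; apply: near_eq_cvg; apply: nearW => n /=.
rewrite mu_block inver invr_eq0 pnatr_eq0 /= invrK /shifted_avg.
have igB : mu.-integrable (block n (cell n x + 2)) (EFin \o g).
  by apply: integrableS ig => //; exact: measurable_block.
by rewrite fineM //; apply: integrable_fin_num igB; exact: measurable_block.
Qed.
End AveragedHilbert.

(** * Transfer of the bounds from [Z] to [X] *)

Section Extension.
Variables (R : realType) (X Z : set (R -> R[i])) (NX NZ : (R -> R[i]) -> R) (c : R).
Local Notation mu := (@lebesgue_measure R).
Hypotheses (bX : is_bfs X NX) (bZ : is_bfs Z NZ) (ZX : forall f, Z f -> X (hilbert f))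
  (TZ : forall f, Z f -> NX (hilbert f) <= c * NZ f).

(** The bound is free of [n]: the [4 * 2^(2n+2)] summands, each of norm at most [|c| * NZ (cplx g)],
    are offset by the factor [3 * pi / 2^(2n+2)]. *)
Lemma bfs_shifted_avg (g : R -> R) n :
  (forall x, 0 <= g x) -> (forall x, ~ I11 x -> g x = 0) ->
  mu.-integrable setT (EFin \o g) -> Z (cplx g) ->
  X (cplx (shifted_avg g n)) /\ NX (cplx (shifted_avg g n)) <= 12 * pi * (`|c| * NZ (cplx g)).
Proof.
move=> g0 g_out ig Zg.
pose h (q : 'I_4 * {ffun 'I_(n.*2.+2) -> bool}) := cplx (modulated g q.1 q.2).
have Zh q : Z (h q) /\ NZ (h q) <= NZ (cplx g).
  apply: (bfs_dominated bZ) => //.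
    apply: cmeas_cplx; apply: measurable_funTS; exact: measurable_modulated.
  by move=> x _; rewrite !cabs_real (ger0_norm (g0 x)); exact: normr_modulated_le.
have [Xs Ns] := bfs_sum_cabs bX (index_enum _) (fun q => ZX (Zh q).1).
pose a : R := 3 * pi / (2 ^ n.*2.+2)%:R.
have a0 : 0 <= a by rewrite divr_ge0 // mulr_ge0 // ltW // pi_gt0.
have [Xa Na] := bfs_scale_cplx bX a0 Xs.
have [XG NG] : X (cplx (shifted_avg g n)) /\ NX (cplx (shifted_avg g n)) <=
    NX (cplx (fun x => a * \sum_(q <- index_enum _) cabs (hilbert (h q) x))).
  apply: (bfs_dominated bX) => //.
    by apply: cmeas_cplx; exact: measurable_shifted_avg.
  move=> x Ix; rewrite !cabs_real (ger0_norm (shifted_avg_ge0 _ _ _)) //.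
  apply: le_trans (@shifted_avg_le R g g0 g_out ig n x Ix) _.
  apply: le_trans (ler_norm _); rewrite ler_wpM2l // ler_sum // => q _.
  (* The real part of [hilbert (h q)] is [hilbR] of the modulated function; its imaginary part need
     not be computed. *)
  exact: (normr_Re_le_cabs (hilbert (h q) x)).
split => //; apply: le_trans NG _; rewrite Na.
apply: le_trans (ler_wpM2l a0 Ns) _.
apply: le_trans (_ : a * (\sum_(q : 'I_4 * {ffun 'I_(n.*2.+2) -> bool}) `|c| * NZ (cplx g)) <= _).
  rewrite ler_wpM2l // ler_sum // => q _; apply: le_trans (TZ (Zh q).1) _.
  (* The sign of [c] is unknown, while enlarging [NZ (h q)] to [NZ (cplx g)] requires a nonnegative
     factor. *)
  apply: le_trans (ler_wpM2r (bfs_norm_ge0 bZ (Zh q).1) (ler_norm c)) _.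
  by rewrite ler_wpM2l // (Zh q).2.
rewrite sumr_const card_prod card_ffun card_bool !card_ord -[_ *+ _]mulr_natl.
rewrite (natrM _ 4 (2 ^ n.*2.+2)) /a.
have : (2 ^ n.*2.+2)%:R != 0 :> R by rewrite pnatr_eq0 expn_eq0.
move: (2 ^ n.*2.+2)%:R => b b0.
rewrite le_eqVlt; apply/orP; left; apply/eqP.
by field.
Qed.

Lemma bfs_extension_trivial : Z `<=` @L1 R -> Z `<=` X.
Proof.
move=> ZL1 f Zf; have [mf intf] := ZL1 _ Zf.
have mcf := measurable_cabs mf.
(* Membership in [Z] says nothing about [f] outside (-1,1); cutting off by zero makes [g] integrable
   on the whole line. *)
pose g := (fun x => cabs (f x)) \_ (@I11 R).
have g_in x : I11 x -> g x = cabs (f x) by move=> Ix; rewrite /g patchE mem_set.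
have g_out x : ~ I11 x -> g x = 0 by move=> Ix; rewrite /g patchE memNset.
have g0 x : 0 <= g x by rewrite /g patchE; case: ifP => // _; exact: cabs_ge0.
have ig : mu.-integrable setT (EFin \o g).
  rewrite /g -restrict_EFin; apply/integrable_restrict => //; first exact: measurable_I11.
  rewrite setTI; apply/integrableP; split; first exact/measurable_EFinP.
  by under eq_integral => x _ do rewrite /= (ger0_norm (cabs_ge0 _)).
have mg : measurable_fun (@I11 R) g.
  by apply: measurable_funTS; have /integrableP[/measurable_EFinP] := ig.
have Zg : Z (cplx g).
  apply: (bfs_dominated bZ Zf (cmeas_cplx mg) _).1 => x Ix.
  by rewrite cabs_real ger0_norm // g_in.
have Xg : X (cplx g).
  apply: (bfs_cvg_bounded bX (u := shifted_avg g) (M := 12 * pi * (`|c| * NZ (cplx g)))) => //.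
  - by move=> n x; exact: shifted_avg_ge0.
  - by move=> n; have [] := bfs_shifted_avg n g0 g_out ig Zg.
  - by move=> n; have [] := bfs_shifted_avg n g0 g_out ig Zg.
  - rewrite /ae11; apply: (@filterS _ _ (ae_filter_ringOfSetsType mu)) (shifted_avg_cvg ig).
    by move=> x ? _.
(* On (-1,1) [f] and [cplx g] have the same modulus, so the ideal property of [X] returns from [g]
   to [f]. *)
apply: (bfs_dominated bX Xg mf _).1 => x Ix.
by rewrite cabs_real ger0_norm // g_in.
Qed.
End Extension.

Theorem theorem4p7 (R : realType) (X : set (R -> R[i])) (NX : (R -> R[i]) -> R) :
  is_ri X NX ->
  ((((1 / 2 : R)%:E < lower_boyd X NX) /\ (lower_boyd X NX <= upper_boyd X NX)
      /\ (upper_boyd X NX < 1%:E))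
   \/ ((0%:E < lower_boyd X NX) /\ (lower_boyd X NX <= upper_boyd X NX)
      /\ (upper_boyd X NX < (1 / 2 : R)%:E)))%E ->
  ~ exists (Z : set (R -> R[i])) (NZ : (R -> R[i]) -> R),
      [/\ is_bfs Z NZ, X `<=` Z, (exists f, Z f /\ ~ X f), Z `<=` @L1 R &
          (forall f, Z f -> X (hilbert f)) /\
          exists c : R, forall f, Z f -> NX (hilbert f) <= c * NZ f].
Proof.
move=> [bX _] _ [Z [NZ [bZ _ [f [Zf nXf]] ZL1 [TX [c Tc]]]]].
exact: nXf (bfs_extension_trivial bX bZ TX Tc ZL1 Zf).
Qed.
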